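(* Let $[s(1),f(1)],\ldots,[s(n),f(n)]$ be closed real intervals with $0\le s(i)\le f(i)$, and let $G$ be their interval graph: vertex set $\{1,\ldots,n\}$, with $i\neq j$ adjacent iff $[s(i),f(i)]\cap[s(j),f(j)]\neq\emptyset$. Let $\mathcal{C}$ be the collection of vertex sets output by the Conflict Cliques algorithm described in the context. Then $\mathcal{C}$ is a minimum edge clique cover of $G$, i.e. every member of $\mathcal{C}$ is a clique of $G$, every edge of $G$ is contained in some member of $\mathcal{C}$, and no collection of fewer cliques of $G$ covers all edges of $G$. Moreover, every clique in $\mathcal{C}$ is a maximal clique of $G$.
   Context: Conflict Cliques algorithm. Input: intervals $[s(i),f(i)]$, $i=1,\ldots,n$. Form a list $L$ of $2n$ events: for each $i$ a start event $(s(i), i)$ and an end event $(f(i), i)$. Sort $L$ by time; at equal times, start events come before end events (ties otherwise arbitrary). Initialize $O:=\emptyset$ (currently open intervals), $\mathcal{C}:=\emptyset$, and a boolean flag $\mathit{new}:=\mathrm{FALSE}$. Process the events in order: at a start event of interval $i$, set $O:=O\cup\{i\}$ and $\mathit{new}:=\mathrm{TRUE}$; at an end event of interval $i$, first, if $\mathit{new}=\mathrm{TRUE}$ and $|O|>1$, add the set $O$ (as it currently is) to $\mathcal{C}$ and set $\mathit{new}:=\mathrm{FALSE}$; then set $O:=O\setminus\{i\}$. Output $\mathcal{C}$. An edge clique cover of a graph is a collection of cliques such that every edge has both endpoints in some clique of the collection. *)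

(* Defs.v *)
From HB Require Import structures.
From mathcomp Require Import all_boot all_order all_algebra.
From mathcomp Require Import boolp classical_sets reals.
Set Implicit Arguments.
Unset Strict Implicit.
Unset Printing Implicit Defensive.
Import Order.TTheory GRing.Theory Num.Theory.
Local Open Scope ring_scope.

(* A finite simple graph is a symmetric irreflexive relation on a finType;
   the intersection graph below satisfies both properties. *)
Section Graphs.
Variables (T : finType) (e : rel T).

Definition clique (A : {set T}) : bool :=
  [forall i in A, forall j in A, (i != j) ==> e i j].

Definition maximal_clique (A : {set T}) : bool := maxset clique A.

Definition edge_clique_cover (C : {set {set T}}) : Prop :=
  (forall A, A \in C -> clique A) /\
  (forall i j, e i j -> exists2 A, A \in C & (i \in A) && (j \in A)).

Definition minimum_edge_clique_cover (C : {set {set T}}) : Prop :=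
  edge_clique_cover C /\
  (forall D : {set {set T}}, edge_clique_cover D -> (#|C| <= #|D|)%N).
End Graphs.

Definition interval_graph (R : realType) (n : nat) (s f : 'I_n -> R) :
    rel 'I_n := fun i j =>
  (i != j) && `[< (`[s i, f i] `&` `[s j, f j] !=set0)%classic >].

Lemma interval_graph_sym (R : realType) (n : nat) (s f : 'I_n -> R) :
  symmetric (interval_graph s f).
Proof. by move=> i j; rewrite /interval_graph eq_sym setIC. Qed.

Lemma interval_graph_irr (R : realType) (n : nat) (s f : 'I_n -> R) :
  irreflexive (interval_graph s f).
Proof. by move=> i; rewrite /interval_graph eqxx. Qed.

Inductive event (n : nat) := Start of 'I_n | End of 'I_n.

Section EventEq.
Variable n : nat.

Definition event_to_sum (v : event n) : 'I_n + 'I_n :=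
  match v with Start i => inl i | End i => inr i end.
Definition event_of_sum (u : 'I_n + 'I_n) : event n :=
  match u with inl i => Start i | inr i => End i end.
Lemma event_to_sumK : cancel event_to_sum event_of_sum.
Proof. by case. Qed.
End EventEq.
HB.instance Definition _ (n : nat) :=
  Equality.copy (event n) (can_type (@event_to_sumK n)).

Definition is_start (n : nat) (v : event n) : bool :=
  if v is Start _ then true else false.

Definition events (n : nat) : seq (event n) :=
  [seq Start i | i <- enum 'I_n] ++ [seq End i | i <- enum 'I_n].

Section EventOrder.
Variables (R : realType) (n : nat) (s f : 'I_n -> R).

Definition event_time (v : event n) : R :=
  match v with Start i => s i | End i => f i end.

Definition event_le (v w : event n) : bool :=
  (event_time v < event_time w) ||
  (event_time v == event_time w) && (is_start w ==> is_start v).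

(* The remaining ties may be broken arbitrarily, so this does not determine
   the list uniquely. *)
Definition event_list (L : seq (event n)) : bool :=
  perm_eq L (events n) && sorted event_le L.

Lemma event_le_total : total event_le.
Proof.
move=> v w; rewrite /event_le.
by case: ltgtP => //= _; case: (is_start v); case: (is_start w).
Qed.

Lemma event_list_sort : event_list (sort event_le (events n)).
Proof.
by rewrite /event_list perm_sort perm_refl (sort_sorted event_le_total).
Qed.
End EventOrder.

Record state (n : nat) := State {
  open_intervals : {set 'I_n};
  cliques : {set {set 'I_n}};
  new : bool }.

Definition init_state (n : nat) : state n :=
  State finset.set0 finset.set0 false.

Definition step (n : nat) (st : state n) (v : event n) : state n :=
  let: State Op C nw := st in
  match v with
  | Start i => State (i |: Op) C true
  | End i => if nw && (1 < #|Op|)%N then State (Op :\ i) (Op |: C) false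
             else State (Op :\ i) C nw
  end.

Definition conflict_cliques (n : nat) (L : seq (event n)) : {set {set 'I_n}} :=
  cliques (foldl (@step n) (init_state n) L).

(* Main.v *)
Require Import Defs.
From HB Require Import structures.
From mathcomp Require Import all_boot all_order all_algebra.
From mathcomp Require Import boolp classical_sets reals.
Set Implicit Arguments.
Unset Strict Implicit.
Unset Printing Implicit Defensive.
Import Order.TTheory GRing.Theory Num.Theory.
Local Open Scope ring_scope.

(** Every set [O] output by the sweep owns an edge [a b] such that each clique
    containing [a] and [b] is included in [O]: take the interval [a] opened
    last before the output, and the interval [b] whose end triggers it (any
    other member of [O] if this is again [a]). An interval outside [O] either
    ended before [a] started, or starts after [b] ended. Such private edges
    make [O] maximal, and two different output sets cannot have their private
    edges in a common clique, so every cover has at least as many cliques.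
    Covering holds because an edge is open as a whole when the first of its two
    endpoints closes, and the open set is then output unless it is included in
    a set that was output since the last start event. *)

Section PrivateEdges.
Variables (T : finType) (e : rel T).

Definition covered (C : {set {set T}}) (i j : T) : Prop :=
  exists2 A, A \in C & (i \in A) && (j \in A).

Definition has_private_edge (A : {set T}) : Prop :=
  exists a b, [/\ e a b, a \in A, b \in A &
    forall B : {set T}, clique e B -> a \in B -> b \in B -> B \subset A].

Lemma cliqueP (A : {set T}) :
  reflect {in A &, forall i j, i != j -> e i j} (clique e A).
Proof.
apply: (iffP forall_inP) => [cA i j iA jA ne|cA i iA].
  by move/forall_inP: (cA i iA) => /(_ j jA) /implyP; apply.
by apply/forall_inP => j jA; apply/implyP; exact: cA.
Qed.

Lemma private_edge_maximal_clique (A : {set T}) :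
  clique e A -> has_private_edge A -> maximal_clique e A.
Proof.
move=> cA [a [b [_ aA bA subA]]]; apply/maxsetP; split=> // B cB sAB.
apply/eqP; rewrite finset.eqEsubset sAB andbT.
by apply: subA => //; apply: (fintype.subsetP sAB).
Qed.

(** Any cover [D] has, for each [A] in [C], a clique through the private edge of [A]. Choosing one
    for each [A] injects [C] into [D]. *)
Lemma private_edges_minimum_cover (C : {set {set T}}) :
  edge_clique_cover e C -> (forall A, A \in C -> has_private_edge A) ->
  minimum_edge_clique_cover e C.
Proof.
move=> [clC covC] privC; split=> // D [clD covD].
(* The endpoints of the private edge are forgotten: this consequence of their lying in [B] is enough
   for injectivity. *)
pose owns (A B : {set T}) := [&& B \in D, B \subset A &
  [forall A' in C, (B \subset A') ==> (A' \subset A)]].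
have ownsE A : A \in C -> exists B, owns A B.
  move=> AC; have [a [b [eab aA bA subA]]] := privC A AC.
  have [B BD /andP[aB bB]] := covD a b eab.
  exists B; apply/and3P; split=> //; first by apply: subA => //; exact: clD.
  apply/forall_inP => A' A'C; apply/implyP => /fintype.subsetP sBA'.
  by apply: subA; [exact: clC|exact: sBA'|exact: sBA'].
(* By [ownsE] the default [A] is never taken when [A] is in [C]. *)
pose g A := odflt A [pick B | owns A B].
have gP A : A \in C -> owns A (g A).
  move=> /ownsE[B oB]; rewrite /g; case: pickP => [//|/(_ B)].
  by rewrite oB.
have g_inj : {in C &, injective g}.
  move=> A A' AC A'C eqg.
  have /and3P[_ sA /forall_inP oA] := gP A AC.
  have /and3P[_ sA' /forall_inP oA'] := gP A' A'C.
  (* The common image lies in both [A] and [A'], so each of them is included in the other. *)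
  apply/eqP; rewrite finset.eqEsubset.
  have /implyP -> := oA' A AC; last by rewrite -eqg.
  by have /implyP -> := oA A' A'C; last by rewrite eqg.
rewrite -(card_in_imset g_inj); apply/subset_leq_card/fintype.subsetP => B.
by move=> /imsetP[A AC ->]; have /and3P[] := gP A AC.
Qed.
End PrivateEdges.

Section Sweep.
Variables (R : realType) (n : nat) (s f : 'I_n -> R).
Hypothesis le_sf : forall i, s i <= f i.

Lemma interval_graphE (i j : 'I_n) :
  interval_graph s f i j = [&& i != j, s i <= f j & s j <= f i].
Proof.
rewrite /interval_graph; congr (_ && _); apply/asboolP/andP.
  move=> [x [/=]]; rewrite !in_itv /= => /andP[sx xf] /andP[sx' xf'].
  by split; [exact: le_trans sx xf'|exact: le_trans sx' xf].
(* The later of the two starts is a common point. *)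
move=> [sij sji]; exists (Order.max (s i) (s j)); split=> /=;
  by rewrite in_itv /= ge_max le_max lexx ?orbT !le_sf ?sij ?sji.
Qed.

Lemma event_le_trans : transitive (event_le s f).
Proof.
move=> v u w; rewrite /event_le.
case/orP => [uv|/andP[/eqP-> suv]]; case/orP => [vw|/andP[/eqP<- svw]].
- by rewrite (lt_trans uv vw).
- by rewrite uv.
- by rewrite vw.
- by rewrite eqxx (introT implyP) ?orbT // => /(implyP svw)/(implyP suv).
Qed.

(** Since starts win ties, this inequality is weak and that of [event_le_end_start] strict, as
    closed intervals require: touching endpoints count as overlap. *)
Lemma event_le_start_end (i j : 'I_n) :
  event_le s f (Start i) (End j) = (s i <= f j).
Proof. by rewrite /event_le /= andbT orbC -le_eqVlt. Qed.

Lemma event_le_end_start (i j : 'I_n) :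
  event_le s f (End i) (Start j) = (f i < s j).
Proof. by rewrite /event_le /= andbF orbF. Qed.

Lemma mem_events (v : event n) : v \in events n.
Proof.
by rewrite mem_cat; case: v => i; rewrite map_f ?mem_enum ?orbT.
Qed.

Lemma uniq_events : uniq (events n).
Proof.
have inj_start : injective (@Start n) by move=> i j [].
have inj_end : injective (@End n) by move=> i j [].
rewrite cat_uniq (map_inj_uniq inj_start) (map_inj_uniq inj_end) enum_uniq andbT.
by apply/hasPn => _ /mapP[i _ ->]; apply/mapP => -[].
Qed.

(** All that the sweep needs to know when the list is cut at the current event. Transitivity extends
    sortedness to distant events; the rest holds because each event occurs exactly once. *)
Lemma event_list_cat (P Q : seq (event n)) : event_list s f (P ++ Q) ->
  [/\ forall u v, u \in P -> v \in Q -> event_le s f u v,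
      forall v, (v \in P) || (v \in Q) &
      forall v, v \in P -> v \notin Q].
Proof.
case/andP=> eqL; rewrite (sorted_pairwise event_le_trans) pairwise_cat.
case/and3P=> /allrelP lePQ _ _; split=> // v.
  by rewrite -mem_cat (perm_mem eqL) mem_events.
have := perm_uniq eqL; rewrite uniq_events cat_uniq => /and3P[_ /hasPn dPQ _] vP.
by apply/negP => /dPQ /=; rewrite vP.
Qed.

(* [P] is the list of the events processed so far. *)
Record sweep_invariant (P : seq (event n)) (st : state n) : Prop := {
  sweep_open : forall i,
    (i \in open_intervals st) = (Start i \in P) && (End i \notin P);
  sweep_cliques : forall A, A \in cliques st ->
    clique (interval_graph s f) A /\ has_private_edge (interval_graph s f) A;
  sweep_new : Defs.new st -> (1 < #|open_intervals st|)%N ->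
    exists2 j, j \in open_intervals st & forall k, End k \in P -> f k < s j;
  sweep_old : ~~ Defs.new st ->
    {in open_intervals st &, forall i j, i != j -> covered (cliques st) i j};
  sweep_closed : forall i j, interval_graph s f i j ->
    Start i \in P -> Start j \in P -> End i \in P ->
    covered (cliques st) i j }.

Lemma covered_sym (C : {set {set 'I_n}}) i j : covered C i j -> covered C j i.
Proof. by case=> A AC ijA; exists A; rewrite // andbC. Qed.

Lemma coveredS (C D : {set {set 'I_n}}) i j :
  C \subset D -> covered C i j -> covered D i j.
Proof. by move=> /fintype.subsetP sCD [A /sCD AD ijA]; exists A. Qed.

(** Starts of open intervals are in [P] and their ends in [Q], so every open interval starts no
    later than any of them ends. *)
Lemma open_clique (P Q : seq (event n)) (Op : {set 'I_n}) :
  event_list s f (P ++ Q) ->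
  (forall i, (i \in Op) = (Start i \in P) && (End i \notin P)) ->
  clique (interval_graph s f) Op.
Proof.
move=> /event_list_cat[lePQ allPQ _] opE; apply/cliqueP.
suff le_open : {in Op &, forall i j, s i <= f j}.
  by move=> i j iO jO ij; rewrite interval_graphE ij !le_open.
move=> i j; rewrite !opE => /andP[iP _] /andP[_ jnP].
by rewrite -event_le_start_end lePQ //; have := allPQ (End j); rewrite (negPf jnP).
Qed.

(** A start of [i] placed after its end would force [f i < s i]. *)
Lemma end_event_open (P Q : seq (event n)) i :
  event_list s f (P ++ End i :: Q) -> (Start i \in P) && (End i \notin P).
Proof.
move=> hL; have [_ _ uPQ] := event_list_cat hL.
move: hL; rewrite -cat_rcons => /event_list_cat[lePQ allPQ _].
apply/andP; split; last first.
  by apply/negP => /uPQ; rewrite in_cons eqxx.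
have := allPQ (Start i); rewrite mem_rcons in_cons /= => /orP[//|iQ].
have := lePQ (End i) (Start i); rewrite mem_rcons mem_head iQ event_le_end_start.
by move=> /(_ isT isT); rewrite ltNge le_sf.
Qed.

Lemma open_private_edge (P Q : seq (event n)) (Op : {set 'I_n}) i j :
  event_list s f (P ++ End i :: Q) ->
  (forall i, (i \in Op) = (Start i \in P) && (End i \notin P)) ->
  (1 < #|Op|)%N -> j \in Op -> (forall k, End k \in P -> f k < s j) ->
  has_private_edge (interval_graph s f) Op.
Proof.
move=> hL opE gt1 jO endP.
have iO : i \in Op by rewrite opE (end_event_open hL).
(* In either case [i] is an endpoint of the edge [j b], so every clique through this edge contains
   [i]. *)
have [b [bO jb ib]] : exists b, [/\ b \in Op, j != b & (i == j) || (i == b)].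
  have [eij|nij] := eqVneq i j; last by exists i; rewrite eqxx orbT eq_sym.
  have : (0 < #|Op :\ j|)%N by move: gt1; rewrite (cardsD1 j) jO.
  by move=> /card_gt0P[b]; rewrite !inE eq_sym => /andP[jb bO]; exists b.
have cO := open_clique hL opE.
exists j, b; split=> //; first exact: (cliqueP _ _ cO).
move=> B /cliqueP cB jB bB; apply/fintype.subsetP => k kB.
have touch a : a \in B -> s k <= f a /\ s a <= f k.
  move=> aB; have [<-|ka] := eqVneq k a; first by rewrite le_sf.
  by have := cB _ _ kB aB ka; rewrite interval_graphE => /and3P[].
have iB : i \in B by case/orP: ib => /eqP->.
(* As [k] meets [j], it cannot have ended yet; as it meets [i], it cannot start after [i] ends. *)
rewrite opE; apply/andP; split; last first.
  by apply/negP => /endP; rewrite ltNge (touch j jB).2.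
move: hL; rewrite -cat_rcons => /event_list_cat[lePQ allPQ _].
have := allPQ (Start k); rewrite mem_rcons in_cons /= => /orP[//|kQ].
have := lePQ (End i) (Start k); rewrite mem_rcons mem_head kQ event_le_end_start.
by move=> /(_ isT isT); rewrite ltNge (touch i iB).1.
Qed.

Lemma sweep_init : sweep_invariant [::] (init_state n).
Proof. by split=> //= [i|A|i j]; rewrite ?inE. Qed.

Lemma sweep_start (P Q : seq (event n)) i st :
  event_list s f (P ++ Start i :: Q) -> sweep_invariant P st ->
  sweep_invariant (rcons P (Start i)) (step st (Start i)).
Proof.
case: st => Op C nw hL [/= opE clC newP oldP closedP].
have [lePQ _ _] := event_list_cat hL.
have endP k : End k \in P -> f k < s i.
  by move=> kP; rewrite -event_le_end_start lePQ ?mem_head.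
have iP : End i \notin P by apply/negP => /endP; rewrite ltNge le_sf.
split=> //=.
- move=> k; rewrite !inE !mem_rcons !in_cons opE /=.
  have -> : (Start k == Start i) = (k == i) by apply/eqP/eqP => [[]|->].
  by have [->|] := eqVneq k i; rewrite ?iP.
(* The interval just opened is itself the witness. *)
- move=> _ _; exists i; rewrite ?setU11 // => k.
  by rewrite mem_rcons in_cons /=; exact: endP.
- move=> a b eab; rewrite !mem_rcons !in_cons /= => aP bP eaP.
  move: eab (eab); rewrite {1}interval_graphE => /and3P[_ _ sbfa] eab.
  (* Neither endpoint is the new interval [i]: it has not ended, whereas [a] has, and strictly
     before [s i]. *)
  case/orP: aP => [/eqP[ai]|aP]; first by move: eaP iP; rewrite ai => ->.
  case/orP: bP => [/eqP[bi]|bP]; last exact: closedP.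
  by have := endP _ eaP; rewrite ltNge -bi sbfa.
Qed.

Lemma sweep_end (P Q : seq (event n)) i st :
  event_list s f (P ++ End i :: Q) -> sweep_invariant P st ->
  sweep_invariant (rcons P (End i)) (step st (End i)).
Proof.
case: st => Op C nw hL [/= opE clC newP oldP closedP].
have iO : i \in Op by rewrite opE (end_event_open hL).
have openE k : (k \in Op :\ i) =
    (Start k \in rcons P (End i)) && (End k \notin rcons P (End i)).
  rewrite !inE !mem_rcons !in_cons opE /=.
  have -> : (End k == End i) = (k == i) by apply/eqP/eqP => [[]|->].
  by rewrite negb_or andbCA.
(* Only edges at [i] are new here. If the other endpoint ended earlier, the invariant applies with
   the roles exchanged; otherwise both endpoints are in [Op]. *)
have closedE (C' : {set {set 'I_n}}) : C \subset C' ->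
    {in Op &, forall a b, a != b -> covered C' a b} ->
    forall a b, interval_graph s f a b -> Start a \in rcons P (End i) ->
    Start b \in rcons P (End i) -> End a \in rcons P (End i) -> covered C' a b.
  move=> sCC' covO a b eab; rewrite !mem_rcons !in_cons /= => aP bP.
  case/orP=> [/eqP[ai]|eaP]; last exact: coveredS (closedP a b eab _ _ _).
  have [ebP|ebP] := boolP (End b \in P).
    apply: coveredS sCC' _; apply/covered_sym/closedP => //.
    by rewrite interval_graph_sym.
  apply: covO; rewrite ?ai ?opE ?bP ?ebP -?opE //.
  by move: eab; rewrite interval_graphE ai => /and3P[].
have [/andP[nwT gt1]|] := boolP (nw && (1 < #|Op|)%N).
  have covO : {in Op &, forall a b, a != b -> covered (Op |: C) a b}.
    by move=> a b aO bO _; exists Op; rewrite ?setU11 // aO bO.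
  split=> //=.
  - move=> A; rewrite in_setU1 => /orP[/eqP->|/clC//].
    have [j jO endP] := newP nwT gt1.
    by split; [exact: open_clique hL opE|exact: open_private_edge hL opE gt1 jO endP].
  - by move=> _ a b; rewrite !inE => /andP[_ aO] /andP[_ bO]; exact: covO.
  - by apply: closedE covO; rewrite finset.subsetUr.
move=> nadd.
(* Without output, either no interval was opened since the last output and [oldP] applies, or [Op]
   has no two distinct members. *)
have covO : {in Op &, forall a b, a != b -> covered C a b}.
  move: nadd; rewrite negb_and => /orP[/oldP//|le1] a b aO bO ab.
  case/negP: le1; apply: leq_trans (subset_leq_card (A := mem [set a; b]) _).
    by rewrite cards2 ab.
  by apply/fintype.subsetP => x; rewrite !inE => /orP[]/eqP->.
split=> //=.
(* If [new] stays true, then [Op] was just [i]; nothing remains open and the size condition of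
   [sweep_new] fails. *)
- move=> nwT; move: nadd; rewrite nwT /= (cardsD1 i) iO -leqNgt => le1 gt1.
  by have := leq_trans (leqW gt1) le1.
- by move=> _ a b; rewrite !inE => /andP[_ aO] /andP[_ bO]; exact: covO.
- exact: closedE covO.
Qed.

Lemma sweep_foldl (P Q : seq (event n)) st :
  event_list s f (P ++ Q) -> sweep_invariant P st ->
  sweep_invariant (P ++ Q) (foldl (@step n) st Q).
Proof.
elim: Q P st => [|v Q IH] P st hL inv; first by rewrite cats0.
rewrite -cat_rcons /=; apply: IH; first by rewrite cat_rcons.
by case: v hL => i hL; [exact: sweep_start hL inv|exact: sweep_end hL inv].
Qed.
End Sweep.

Theorem theorem1 (R : realType) (n : nat) (s f : 'I_n -> R)
    (hsf : forall i : 'I_n, 0 <= s i /\ s i <= f i)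
    (L : seq (event n)) (hL : event_list s f L) :
  minimum_edge_clique_cover (interval_graph s f) (conflict_cliques L) /\
  (forall A : {set 'I_n}, A \in conflict_cliques L ->
     maximal_clique (interval_graph s f) A).
Proof.
have le_sf i : s i <= f i by case: (hsf i).
have [_ clC _ _ covC] :=
  sweep_foldl le_sf (P := [::]) hL (sweep_init s f).
(* At the end of the list every interval has started and ended, so [sweep_closed] reaches every
   edge. *)
have memL v : v \in L.
  by case/andP: hL => eqL _; rewrite (perm_mem eqL) mem_events.
split; last by move=> A /clC[]; exact: private_edge_maximal_clique.
apply: private_edges_minimum_cover; last by move=> A /clC[].
by split=> [A /clC[]//|i j eij]; exact: covC.
Qed.
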